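(* Let $f$ be locally absolutely continuous on $(0,1)$ with $f(0)=0$ and $|f(r)|\le\omega$ for $0<r<1$, and suppose $$E=\int_0^1\frac{|f_r|^2}{r}\,dr<\infty.$$ Then $$\int_0^1\frac{|f|^2}{r}\,dr\le\omega^2\left[\frac14+\frac12\log\left(1+\frac{E}{\omega^2}\right)\right],$$ where the right-hand side is read as $0$ when $\omega=0$.
   Context: $f$ is a real function of $r$, $f_r$ is its derivative, $f(0)=0$ means $\lim_{r\downarrow0}f(r)=0$, and $\omega\ge0$ is a constant. *)

(* Defs.v *)
From mathcomp Require Import all_boot all_order all_algebra.
From mathcomp Require Import all_classical all_reals all_analysis.

Set Implicit Arguments.
Unset Strict Implicit.
Unset Printing Implicit Defensive.

Import Order.TTheory GRing.Theory Num.Theory.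
Import numFieldNormedType.Exports.

Local Open Scope classical_set_scope.
Local Open Scope ring_scope.

(* Absolute continuity on [a, b], over finite families of non-overlapping
   subintervals [x i, y i]; degenerate intervals are allowed and contribute 0
   to both sums. *)
Definition abs_continuous (R : realType) (a b : R) (f : R -> R) : Prop :=
  forall e : R, 0 < e -> exists2 d : R, 0 < d &
    forall (n : nat) (x y : 'I_n -> R),
      (forall i, a <= x i /\ x i <= y i /\ y i <= b) ->
      trivIset setT (fun i => `]x i, y i[%classic) ->
      \sum_(i < n) (y i - x i) < d ->
      \sum_(i < n) `|f (y i) - f (x i)| < e.

Definition locally_abs_continuous (R : realType) (a b : R) (f : R -> R) : Prop :=
  forall c d : R, a < c -> c <= d -> d < b -> abs_continuous c d f.

(* [derive1 f] is 0 at the points where [f] is not differentiable; for a locally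
   absolutely continuous [f] these form a Lebesgue null set. *)
Definition energy (R : realType) (f : R -> R) : \bar R :=
  (\int[lebesgue_measure]_(r in `]0%R, 1%R[) (`|derive1 f r| ^+ 2 / r)%:E)%E.

(* Main.v *)
(** Cauchy-Schwarz gives [|f r|^2 <= r^2 E / 2].  Use this bound on [(0, d]] and
    [|f| <= omega] on [(d, 1)]: the integral is at most
    [E d^2 / 4 - omega^2 log d], and [d^2 = omega^2 / (E + omega^2)] gives the
    claim.
    The work lies in [f r - f a = \int_a^r f'], which needs that an absolutely
    continuous function is differentiable almost everywhere.  The total
    variation [V] of [f] is absolutely continuous, so [V] and [V - f] are
    nondecreasing and absolutely continuous; their Stieltjes measures are
    dominated by Lebesgue measure, so Radon-Nikodym makes [f] an indefinite
    integral, and Lebesgue differentiation identifies the density with [f']. *)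

Require Import Defs.
From HB Require Import structures.
From mathcomp Require Import all_boot all_order all_algebra.
From mathcomp Require Import all_classical all_reals all_analysis.
From mathcomp Require Import measurable_realfun ring lra.

Set Implicit Arguments.
Unset Strict Implicit.
Unset Printing Implicit Defensive.

Import Order.TTheory GRing.Theory Num.Theory.
Import numFieldNormedType.Exports.

Local Open Scope classical_set_scope.
Local Open Scope ring_scope.

(** * Chains of intervals and the absolute continuity of the total variation *)

(* Unlike the families of intervals in [abs_continuous], chains concatenate. *)
Fixpoint chain (R : realType) (a b : R) (s : seq (R * R)) : bool :=
  if s is p :: t then [&& a <= p.1, p.1 <= p.2 & chain p.2 b t] else a <= b.

Definition chain_length (R : realType) (s : seq (R * R)) : R :=
  \sum_(p <- s) (p.2 - p.1).

Definition chain_var (R : realType) (f : R -> R) (s : seq (R * R)) : R :=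
  \sum_(p <- s) `|f p.2 - f p.1|.

(** The final inequality is weak so that it survives the supremum in the total variation. *)
Definition chain_ac (R : realType) (a b : R) (f : R -> R) : Prop :=
  forall e : R, 0 < e -> exists2 d : R, 0 < d &
    forall s, chain a b s -> chain_length s < d -> chain_var f s <= e.

Section chains.
Context {R : realType}.
Implicit Types (a b c x y : R) (s : seq (R * R)) (f g : R -> R).

Lemma chain_le a b s : chain a b s -> a <= b.
Proof.
elim: s a => //= p s ih a /and3P[ap p12 /ih]; lra.
Qed.

Lemma chain_widen a b c s : c <= a -> chain a b s -> chain c b s.
Proof.
case: s => [|p s] /= ca; first exact: le_trans.
by move=> /and3P[/(le_trans ca) -> -> ->].
Qed.

Lemma chain_widen_right a b c s : b <= c -> chain a b s -> chain a c s.
Proof.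
move=> bc; elim: s a => /= [a ab|p s ih a]; first exact: le_trans bc.
by move=> /and3P[-> -> /ih].
Qed.

Lemma chain_cat a b c s (t : seq (R * R)) :
  chain a b s -> chain b c t -> chain a c (s ++ t).
Proof.
elim: s a => /= [a|p s ih a]; first exact: chain_widen.
by move=> /and3P[-> -> /ih h] /h.
Qed.

Lemma chain_bounds a b s p : chain a b s -> p \in s ->
  [/\ a <= p.1, p.1 <= p.2 & p.2 <= b].
Proof.
elim: s a => //= q s ih a /and3P[aq q12 qs]; rewrite inE => /predU1P[->|ps].
  by split => //; exact: chain_le qs.
by have [? ? ?] := ih _ qs ps; split => //; lra.
Qed.

Lemma chain_nth a b s p0 i j : chain a b s -> (i < j < size s)%N ->
  (nth p0 s i).2 <= (nth p0 s j).1.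
Proof.
elim: s a i j => //= [a i j|q s ih a i [//|j]]; first by rewrite ltn0 andbF.
move=> /and3P[aq q12 qs]; case: i => [|i] /=; rewrite !ltnS => ij.
  by have [] := chain_bounds qs (mem_nth p0 ij).
exact: ih qs ij.
Qed.

Lemma chain_length_cat s (t : seq (R * R)) :
  chain_length (s ++ t) = chain_length s + chain_length t.
Proof. by rewrite /chain_length big_cat. Qed.

Lemma chain_var_cat f s (t : seq (R * R)) :
  chain_var f (s ++ t) = chain_var f s + chain_var f t.
Proof. by rewrite /chain_var big_cat. Qed.

Lemma chain_var_ge0 f s : 0 <= chain_var f s.
Proof. exact: sumr_ge0. Qed.

(** A chain runs from left to right, so its open intervals, indexed by position, are pairwise
    disjoint. *)
Lemma abs_continuous_chain_ac a b f : abs_continuous a b f -> chain_ac a b f.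
Proof.
move=> fac e e0; have [d d0 H] := fac e e0; exists d => // s cs ls.
pose x (i : 'I_(size s)) := (nth (0, 0) s i).1.
pose y (i : 'I_(size s)) := (nth (0, 0) s i).2.
have := H _ x y.
rewrite /chain_length (big_nth (0, 0)) big_mkord in ls.
rewrite /chain_var (big_nth (0, 0)) big_mkord => h; apply/ltW/h => //.
  move=> i; have [] := chain_bounds cs (mem_nth (0, 0) (ltn_ord i)).
  by [].
apply/trivIsetP => i j _ _ ij.
wlog lij : i j ij / (i < j)%N => [hw|].
  have : (i < j)%N || (j < i)%N by rewrite -neq_ltn.
  by case/orP => ?; [exact: hw|rewrite setIC; apply: hw => //; rewrite eq_sym].
rewrite -subset0 => z [] /=; rewrite !in_itv/= => /andP[_ zi] /andP[jz _].
have : y i <= x j by apply: (chain_nth _ cs); rewrite lij ltn_ord.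
lra.
Qed.

Lemma chain_acB a b f g : chain_ac a b f -> chain_ac a b g ->
  chain_ac a b (f \- g).
Proof.
move=> fac gac e e0; have e2 : 0 < e / 2 by lra.
have [d d0 Hd] := fac _ e2; have [k k0 Hk] := gac _ e2.
exists (Num.min d k) => [|s cs]; first by rewrite lt_min d0.
rewrite lt_min => /andP[sd sk].
have := Hd s cs sd; have := Hk s cs sk.
suff : chain_var (f \- g) s <= chain_var f s + chain_var g s by lra.
rewrite /chain_var -big_split/=; apply: ler_sum => p _.
have -> : (f \- g) p.2 - (f \- g) p.1 = f p.2 - f p.1 - (g p.2 - g p.1).
  by move=> /=; ring.
exact: ler_normB.
Qed.

Lemma chain_ac_dist a b f : chain_ac a b f -> forall e, 0 < e ->
  exists2 d, 0 < d & forall x y, a <= x -> x <= b -> a <= y -> y <= b ->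
    `|y - x| < d -> `|f y - f x| <= e.
Proof.
move=> fac e /fac[d d0 H]; exists d => // x y.
wlog xy : x y / x <= y => [hw ? ? ? ?|].
  have [|/ltW] := leP x y => xy; first exact: hw.
  by rewrite distrC => ?; rewrite distrC; apply: hw.
move=> ax xb ay yb; rewrite ger0_norm ?subr_ge0// => yxd.
have := H [:: (x, y)].
rewrite /chain_length /chain_var !big_cons !big_nil !addr0/=.
by apply; rewrite ?ax ?xy.
Qed.

(** Pairing [a :: s] with [s] lists the cells of the partition; this carries chain estimates over to
    [variation]. *)
Lemma itv_partition_chain a b f (s : seq R) : itv_partition a b s ->
  exists t, [/\ chain a b t, chain_length t = b - a &
    chain_var f t = variation a b f s].
Proof.
move=> abs; exists (zip (a :: s) s); split.
- elim: s a abs => [a|h s ih a] [/=]; first by move=> _ /eqP ->.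
  move=> /andP[ah hs] hb; rewrite lexx (ltW ah)/=; apply: ih.
  by split.
- rewrite /chain_length; elim: s a abs => [a [/= _ /eqP ->]|h s ih a [/=]].
    by rewrite big_nil subrr.
  move=> /andP[ah hs] hb; by rewrite big_cons ih//=; lra.
rewrite variation_zip// /chain_var; elim: s a {abs} => [a|h s ih a] /=.
  by rewrite !big_nil.
by rewrite !big_cons ih/= distrC.
Qed.

(** For [e = 1], any piece shorter than [d] has variation at most 1. Finitely many steps of [d / 2],
    cut off at [b], exhaust [[a, b]], and total variation is additive. *)
Lemma chain_ac_bounded_variation a b f : a <= b -> chain_ac a b f ->
  bounded_variation a b f.
Proof.
move=> ab fac; have [d d0 H] := fac 1 ltr01.
have small x y : a <= x -> x <= y -> y <= b -> y - x < d ->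
    bounded_variation x y f.
  move=> ax xy yb yxd; exists 1 => _ [s ps <-].
  have [t [ct lt <-]] := itv_partition_chain f ps.
  apply: H; last by rewrite lt.
  exact: chain_widen ax (chain_widen_right yb ct).
have [n bn] : exists n : nat, b < a + n%:R * (d / 2).
  exists (Num.bound ((b - a) / (d / 2))).
  by rewrite -ltrBlDl -ltr_pdivrMr ?unstable.ltr_bound// divr_gt0.
suff : bounded_variation a (Num.min b (a + n%:R * (d / 2))) f.
  by rewrite min_l// ltW.
elim: n {bn} => [|n ih].
  by rewrite mul0r addr0 min_r//; exact: bounded_variationxx.
set u := Num.min b (a + n%:R * (d / 2)) in ih *; set v := Num.min b _.
have n0 : 0 <= n%:R * (d / 2) by apply: mulr_ge0; [exact: ler0n|lra].
have au : a <= u by rewrite /u le_min ab; lra.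
have [uv vu vb] : [/\ u <= v, v - u < d & v <= b].
  have nS : n.+1%:R * (d / 2) = n%:R * (d / 2) + d / 2.
    by rewrite -addn1 natrD mulrDl mul1r.
  rewrite /u /v nS; have [?|?] := leP b (a + n%:R * (d / 2));
    have [?|?] := leP b (a + (n%:R * (d / 2) + d / 2)); split; lra.
have av := le_trans au uv.
apply/(bounded_variationP _ av).
rewrite (total_variationD f au uv) fin_numD.
apply/andP; split; first exact/(bounded_variationP _ au).
by apply/(bounded_variationP _ uv); exact: small.
Qed.

(** Replacing each interval of [s] by a partition of it gives another chain of the same length,
    which is why the hypothesis ranges over all such chains. The suprema are taken one interval at a
    time, by induction. *)
Lemma sum_total_variation_le a b f s (M : R) : chain a b s ->
  (forall t, chain a b t -> chain_length t = chain_length s ->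
     chain_var f t <= M) ->
  (\sum_(p <- s) total_variation p.1 p.2 f <= M%:E)%E.
Proof.
elim: s a M => [a M cs H|p s ih a M /= /and3P[ap p12 ps] H].
  by rewrite big_nil lee_fin (le_trans _ (H _ cs erefl))// chain_var_ge0.
rewrite big_cons.
set S := (\sum_(q <- s) _)%E.
(* With the partition [t] of the first interval fixed, the induction hypothesis applies to the tail
   with [M] lowered by the variation along [t]. *)
have key t : itv_partition p.1 p.2 t ->
    (S <= M%:E - (variation p.1 p.2 f t)%:E)%E.
  move=> /(itv_partition_chain f)[u [cu lu <-]].
  rewrite -EFinB; apply: ih ps _ => v cv lv; rewrite lerBrDl -chain_var_cat.
  apply: H; first exact: chain_cat (chain_widen ap cu) cv.
  by rewrite chain_length_cat lu lv /chain_length big_cons.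
(* Finiteness lets [S] change sides, so that the supremum over [t] can be taken. *)
have Sfin : S \is a fin_num.
  have S0 : (0 <= S)%E.
    rewrite /S big_seq; apply: sume_ge0 => q qs; apply: total_variation_ge0.
    by have [] := chain_bounds ps qs.
  have [t pt] : exists t, itv_partition p.1 p.2 t.
    move: p12; rewrite le_eqVlt => /predU1P[->|p12].
      by exists [::]; split => //=.
    by exists [:: p.2]; exact: itv_partition1.
  by rewrite ge0_fin_numE// (le_lt_trans (key _ pt))// -EFinB ltry.
rewrite -leeBrDr//; apply: ge_ereal_sup => _ [_ [t pt <-] <-].
by rewrite leeBrDr// addeC -leeBrDr//; exact: key.
Qed.

Definition tv_fun a f x : R := fine (total_variation a x f).

Lemma tv_funB a b f x y : bounded_variation a b f -> a <= x -> x <= y ->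
  y <= b -> (total_variation x y f = (tv_fun a f y - tv_fun a f x)%:E)%E.
Proof.
move=> bf ax xy yb; rewrite /tv_fun.
have ay := le_trans ax xy; have xb := le_trans xy yb.
have fx : total_variation a x f \is a fin_num.
  by apply/bounded_variationP => //; exact: bounded_variationl bf.
have fy : total_variation a y f \is a fin_num.
  by apply/bounded_variationP => //; exact: bounded_variationl bf.
rewrite EFinB !fineK// (total_variationD f ax xy).
by rewrite addeAC subee// add0e.
Qed.

Lemma normr_le_tv_funB a b f x y : bounded_variation a b f -> a <= x ->
  x <= y -> y <= b -> `|f y - f x| <= tv_fun a f y - tv_fun a f x.
Proof.
move=> bf ax xy yb; rewrite -lee_fin -(tv_funB bf ax xy yb).
exact: total_variation_ge.
Qed.

(** The [d] that serves [f] serves its variation too, since refining a chain keeps its length. *)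
Lemma chain_ac_tv_fun a b f : a <= b -> chain_ac a b f ->
  chain_ac a b (tv_fun a f).
Proof.
move=> ab fac; have bf := chain_ac_bounded_variation ab fac.
move=> e /fac[d d0 H]; exists d => // s cs sd; rewrite -lee_fin.
apply: le_trans (sum_total_variation_le cs (M := e) (f := f) _).
  rewrite /chain_var -sumEFin big_seq [leRHS]big_seq.
  apply: lee_sum => p ps; have [ap p12 pb] := chain_bounds cs ps.
  rewrite (tv_funB bf ap p12 pb) lee_fin ger0_norm// subr_ge0 -subr_ge0.
  exact: le_trans (normr_ge0 _) (normr_le_tv_funB bf ap p12 pb).
by move=> t ct lt; apply: H => //; rewrite lt.
Qed.

End chains.

(** * Grids whose cells []x k, y k]] may be empty *)

Section grid.
Context {R : realType}.
Variables (x y : nat -> R).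
Hypothesis xy : forall k, x k <= y k.
Hypothesis yx : forall k, y k <= x k.+1.

Let x_nd : nondecreasing_seq x.
Proof. by apply/nondecreasing_seqP => k; exact: le_trans (xy k) (yx k). Qed.

Lemma chain_grid m n :
  chain (x m) (x (m + n)%N) [seq (x k, y k) | k <- iota m n].
Proof.
elim: n m => [|n ih] m /=; first by rewrite addn0.
rewrite lexx xy/= addnS -addSn.
exact: chain_widen (yx m) (ih m.+1).
Qed.

Lemma trivIset_grid : trivIset setT (fun k => `]x k, y k]%classic).
Proof.
apply/trivIsetP => i j _ _ ij.
wlog lij : i j ij / (i < j)%N => [hw|].
  have : (i < j)%N || (j < i)%N by rewrite -neq_ltn.
  by case/orP => ?; [exact: hw|rewrite setIC; apply: hw => //; rewrite eq_sym].
rewrite -subset0 => z [] /=; rewrite !in_itv/= => /andP[_ zi] /andP[jz _].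
have := x_nd lij; have := yx i; lra.
Qed.

End grid.

(** * Null sets of the Stieltjes measure of an absolutely continuous function *)

Section lebesgue_stieltjes.
Context {R : realType}.
Implicit Types (G : cumulative R R) (a b r : R) (U : set R).

Notation mu := (@lebesgue_measure R).

Lemma lebesgue_stieltjes_measure_itvoc G a b : a <= b ->
  lebesgue_stieltjes_measure G `]a, b]%classic = (G b - G a)%:E.
Proof.
move=> ab; rewrite /lebesgue_stieltjes_measure/= /measure_extension/=.
rewrite measurable_mu_extE//; last exact: is_ocitv.
exact: wlength_itv_bnd.
Qed.

(** The complement is the union of the open balls of radius [r] centred outside [U]. Closedness is
    what makes the erosion measurable. *)
Lemma closed_eroded r U : closed [set z | ball z r `<=` U].
Proof.
rewrite -openC (_ : ~` _ = \bigcup_(w in ~` U) ball w r).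
  by apply: bigcup_open => w _; exact: ball_open.
apply/seteqP; split=> z /=.
  move=> /existsNP[w /not_implyP[zw Uw]]; exists w => //; exact: ball_sym.
by move=> [w Uw wz] /(_ w (ball_sym wz)).
Qed.

Lemma grid_ex (x : nat -> R) N z : x 0%N < z -> z <= x N ->
  exists2 k, (k < N)%N & x k < z <= x k.+1.
Proof.
elim: N => [|N ih] x0 zN; first lra.
have [zN'|Nz] := leP z (x N).
  by have [k kN kz] := ih x0 zN'; exists k => //; exact: ltnW.
by exists N; rewrite ?Nz.
Qed.

(* The cells of a mesh finer than [r] that meet the [r]-erosion of [U] lie
   in [U]. *)
Lemma lebesgue_stieltjes_eroded_le G a b r U (e d : R) : a < b -> 0 < r ->
  open U -> (mu U < d%:E)%E ->
  (forall s, chain a b s -> chain_length s < d -> chain_var G s <= e) ->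
  (lebesgue_stieltjes_measure G ([set z | ball z r `<=` U] `&` `]a, b]) <=
     e%:E)%E.
Proof.
move=> ab r0 oU Ud He.
set nu := lebesgue_stieltjes_measure G.
have [N N0 Nr] : exists2 N : nat, (0 < N)%N & (b - a) / N%:R < r.
  exists (Num.bound ((b - a) / r)).+1 => //.
  rewrite ltr_pdivrMr// mulrC -ltr_pdivrMr//.
  by rewrite (lt_trans (unstable.ltr_bound _))// ltr_nat.
have N0' : 0 < N%:R :> R by rewrite ltr0n.
set h := (b - a) / N%:R in Nr.
have h0 : 0 <= h by rewrite /h divr_ge0// subr_ge0 ltW.
pose x k : R := a + k%:R * h.
have xS k : x k.+1 = x k + h by rewrite /x -addn1 natrD mulrDl mul1r addrA.
have x0 : x 0%N = a by rewrite /x mul0r addr0.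
have xN : x N = b.
  by rewrite /x /h mulrC divfK ?gt_eqF// addrC subrK.
(* A cell that is not inside [U] is collapsed to the empty set, so it adds nothing to either sum. *)
pose y k := if `[< `]x k, x k.+1] `<=` U >] then x k.+1 else x k.
have xy k : x k <= y k by rewrite /y xS; case: ifP => _; lra.
have yx k : y k <= x k.+1 by rewrite /y xS; case: ifP => _; lra.
have cellU k : `]x k, y k] `<=` U.
  rewrite /y; case: ifPn => [/asboolP//|_] z.
  by rewrite set_itvoc0.
pose s := [seq (x k, y k) | k <- iota 0 N].
have cs : chain a b s.
  by have := chain_grid xy yx 0%N N; rewrite add0n x0 xN.
have sum_s (F : R -> R) :
    \sum_(p <- s) (F p.2 - F p.1) = \sum_(k < N) (F (y k) - F (x k)).
  by rewrite /s big_map -[in LHS](subn0 N) big_mkord.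
pose F k : set R := `]x k, y k]%classic.
have mcell k : measurable (F k) by exact: measurable_itv.
(* The kept cells are disjoint and lie in [U], so their total length is at most [mu U]. *)
have lens : (chain_length s < d).
  rewrite -lte_fin (le_lt_trans _ Ud)// /chain_length (sum_s idfun) -sumEFin.
  rewrite (eq_bigr (fun k : 'I_N => mu (F k))); last first.
    by move=> k _; rewrite /lebesgue_measure lebesgue_stieltjes_measure_itvoc.
  rewrite -(measure_bigsetU mu mcell (trivIset_grid xy yx) N).
  apply: le_measure; rewrite ?inE.
  - by apply: bigsetU_measurable => k _; exact: mcell.
  - exact: open_measurable.
  - by rewrite -(bigcup_mkord N F) => z [k _ /cellU].
apply: (@le_trans _ _ (\sum_(k < N) nu (F k))%E).
  apply: le_trans (Boole_inequality nu (fun k _ => mcell k)).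
  apply: le_measure; rewrite ?inE.
  - apply: measurableI; last exact: measurable_itv.
    by apply: closed_measurable; exact: closed_eroded.
  - by apply: bigsetU_measurable => k _; exact: mcell.
  - move=> z [/= zU]; rewrite in_itv/= => /andP[az zb].
    have [||k kN /andP[kz zk]] := @grid_ex x N z; rewrite ?x0 ?xN//.
    rewrite -(bigcup_mkord N F); exists k => //.
    rewrite /F/= in_itv/= kz/= /y ifT//.
    (* The cell containing [z] is narrower than [r], hence lies in [ball z r]. *)
    apply/asboolP => w /=; rewrite in_itv/= => /andP[kw wk]; apply: zU.
    rewrite /ball/= ltr_norml; move: zk wk; rewrite xS; lra.
rewrite (eq_bigr (fun k : 'I_N => (G (y k) - G (x k))%:E)); last first.
  by move=> k _; rewrite /nu lebesgue_stieltjes_measure_itvoc.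
rewrite sumEFin lee_fin -sum_s (le_trans _ (He s cs lens))//.
by apply: ler_sum => p _; exact: ler_norm.
Qed.

(** Outer regularity encloses [A] in an open [U] of measure below [d]. Chains are finite while [U]
    may have infinitely many components, so the bound is proved on the erosions of [U]; these
    increase to [U], and continuity from below passes to the limit. *)
Lemma lebesgue_stieltjes_null G a b (A : set R) : a < b -> chain_ac a b G ->
  measurable A -> mu A = 0 ->
  lebesgue_stieltjes_measure G (A `&` `]a, b]) = 0.
Proof.
move=> ab Gac mA A0; apply/eqP; rewrite eq_le measure_ge0 andbT.
apply/lee_addgt0Pr => e e0; rewrite add0e.
have [d d0 He] := Gac _ e0.
have Alty : (mu A < +oo)%E by rewrite A0.
have [U [oU AU UA]] := lebesgue_regularity_outer mA Alty d0.
have mU : measurable U by exact: open_measurable.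
have Ud : (mu U < d%:E)%E.
  have UDA : (mu U <= mu A + mu (U `\` A))%E.
    by rewrite -{1}(setDUK AU); apply: measureU2 => //; exact: measurableD.
  by apply: le_lt_trans UDA _; rewrite A0 add0e.
set nu := lebesgue_stieltjes_measure G.
pose E n := [set z | ball z n.+1%:R^-1 `<=` U] `&` `]a, b].
have mE n : measurable (E n).
  apply: measurableI; last exact: measurable_itv.
  by apply: closed_measurable; exact: closed_eroded.
have UE : U `&` `]a, b] `<=` \bigcup_n E n.
  move=> z [Uz zab]; have /nbhs_ballP[r /= r0 rU] : nbhs z U.
    exact: open_nbhs_nbhs.
  have [n _ nr] := near_infty_natSinv_lt (PosNum r0).
  exists n => //; split => //=; apply: subset_trans rU; apply: le_ball.
  exact/ltW/(nr _ (leqnn n)).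
apply: (@le_trans _ _ (nu (\bigcup_n E n))).
  apply: le_measure; rewrite ?inE.
  - by apply: measurableI => //; exact: measurable_itv.
  - exact: bigcupT_measurable.
  - by apply: subset_trans UE; exact: setSI.
have Ecvg : (nu \o E) n @[n --> \oo] --> nu (\bigcup_n E n).
  apply: nondecreasing_cvg_mu => //; first exact: bigcupT_measurable.
  move=> n m nm; apply/subsetPset; apply: setSI => z /= nz.
  apply: subset_trans nz; apply: le_ball.
  by rewrite lef_pV2 ?posrE// ler_nat.
rewrite -(cvg_lim _ Ecvg)//.
apply: lime_le; first by apply/cvg_ex; eexists; exact: Ecvg.
by apply: nearW => n; apply: lebesgue_stieltjes_eroded_le Ud He.
Qed.

End lebesgue_stieltjes.

(** * Absolutely continuous functions as integrals of their derivatives *)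

Section absolutely_continuous_integral.
Context {R : realType}.
Implicit Types (G : cumulative R R) (a b : R) (f : R -> R).

Notation mu := (@lebesgue_measure R).

Lemma cumulative_ac_integral G a b : a < b -> chain_ac a b G ->
  exists2 g : R -> R, mu.-integrable setT (EFin \o g) &
    forall x, a <= x -> x <= b -> G x - G a = \int[mu]_(t in `]a, x]) g t.
Proof.
move=> ab Gac.
have mab : measurable (`]a, b]%classic : set (measurableTypeR R)).
  exact: measurable_itv.
have fin_ab : (lebesgue_stieltjes_measure G `]a, b]%classic < +oo)%E.
  by rewrite lebesgue_stieltjes_measure_itvoc ?ltry// ltW.
(* Restricting to []a, b]] gives the finite measure that Radon-Nikodym takes here. *)
pose nu : {finite_measure set (measurableTypeR R) -> \bar R} :=
  mfrestr mab fin_ab.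
have nu_mu : nu `<< (mu : {sigma_finite_measure set _ -> \bar R}).
  apply/null_content_dominatesP => A mA A0.
  exact: lebesgue_stieltjes_null ab Gac mA A0.
have [g [g0 gfin ig gE]] := radon_nikodym_sigma_finite nu_mu.
have gfine : EFin \o (fine \o g) = g by apply/funext => x /=; rewrite fineK.
exists (fine \o g); first by rewrite gfine.
move=> x ax xb; rewrite /Rintegral.
rewrite (eq_integral g); last by move=> t _ /=; rewrite fineK.
rewrite -gE; last exact: measurable_itv.
rewrite /nu/= /mfrestr/= /mrestr/= setIidl; last first.
  by apply: subset_itvl; rewrite bnd_simp.
by rewrite lebesgue_stieltjes_measure_itvoc.
Qed.

(** A [cumulative] function lives on the whole line, so [f] is composed with the clamp [c] onto
    [[a, b]], which is monotone and 1-Lipschitz. *)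
Lemma nondecreasing_cumulative a b f : a <= b ->
  {in `[a, b] &, {homo f : x y / x <= y}} -> chain_ac a b f ->
  exists G : cumulative R R, {in `[a, b], G =1 f}.
Proof.
move=> ab fnd fac.
pose c x := Num.max a (Num.min x b).
have cab x : c x \in `[a, b].
  by rewrite in_itv/= /c le_max lexx/= ge_max ab ge_min lexx orbT.
have cE : {in `[a, b], c =1 id}.
  move=> x; rewrite in_itv/= => /andP[ax xb].
  by rewrite /c min_l// max_r.
have cnd x y : x <= y -> c x <= c y.
  by move=> xy; rewrite /c; apply: le_max2 => //; exact: le_min2.
have cdist x y : `|c y - c x| <= `|y - x|.
  wlog xy : x y / x <= y => [hw|].
    have [|/ltW] := leP x y; first exact: hw.
    by rewrite distrC (distrC y); exact: hw.
  rewrite !ger0_norm ?subr_ge0 ?cnd//.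
  rewrite /c; have [?|?] := leP x b; have [?|?] := leP y b; try lra.
  - by have [?|?] := leP a x; have [?|?] := leP a y; lra.
  - by have [?|?] := leP a x; have [?|?] := leP a b; lra.
have fc_nd : nondecreasing (f \o c).
  by move=> x y /cnd; apply: fnd.
have fc_rc : right_continuous (f \o c).
  apply: right_continuousW => x.
  apply/cvgrPdist_le => e /(chain_ac_dist fac)[d d0 H].
  near=> y => /=; rewrite distrC.
  move: (cab x) (cab y); rewrite !in_itv/= => /andP[? ?] /andP[? ?].
  apply: H => //; apply: le_lt_trans (cdist _ _) _; rewrite distrC.
  by near: y; exact: (nbhsx_ballx x d d0).
pose G : cumulative R R :=
  HB.pack (f \o c) (isCumulative.Build R _ R (f \o c) fc_nd fc_rc).
by exists G => x xab; rewrite /G/= cE.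
Unshelve. all: by end_near. Qed.

Lemma chain_ac_eq a b f h : {in `[a, b], f =1 h} -> chain_ac a b f ->
  chain_ac a b h.
Proof.
move=> fh fac e /fac[d d0 H]; exists d => // s cs sd.
rewrite (le_trans _ (H s cs sd))// /chain_var big_seq [leRHS]big_seq.
apply: ler_sum => p ps; have [ap p12 pb] := chain_bounds cs ps.
by rewrite !fh// in_itv/= ?ap ?pb ?(le_trans ap)// (le_trans p12).
Qed.

Lemma nondecreasing_ac_integral a b f : a < b ->
  {in `[a, b] &, {homo f : x y / x <= y}} -> chain_ac a b f ->
  exists2 g : R -> R, mu.-integrable setT (EFin \o g) &
    forall x, a <= x -> x <= b -> f x - f a = \int[mu]_(t in `]a, x]) g t.
Proof.
move=> ab fnd fac; have [G Gf] := nondecreasing_cumulative (ltW ab) fnd fac.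
have [|g ig gE] := @cumulative_ac_integral G a b ab.
  by apply: chain_ac_eq fac => x xab; rewrite Gf.
exists g => // x ax xb; rewrite -gE// !Gf// in_itv/= ?ax ?lexx//.
exact: ltW.
Qed.

Lemma ac_integral a b f : a < b -> chain_ac a b f ->
  exists2 g : R -> R, mu.-integrable setT (EFin \o g) &
    forall x, a <= x -> x <= b -> f x - f a = \int[mu]_(t in `]a, x]) g t.
Proof.
move=> ab fac; have bf := chain_ac_bounded_variation (ltW ab) fac.
have Vac := chain_ac_tv_fun (ltW ab) fac.
have nV x y : x \in `[a, b] -> y \in `[a, b] -> x <= y ->
    `|f y - f x| <= tv_fun a f y - tv_fun a f x.
  rewrite !in_itv/= => /andP[ax _] /andP[_ yb] xy.
  exact: normr_le_tv_funB bf ax xy yb.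
have [|g ig gE] := nondecreasing_ac_integral ab _ Vac.
  by move=> x y xab yab /(nV _ _ xab yab); have := normr_ge0 (f y - f x); lra.
have [|h ih hE] := nondecreasing_ac_integral ab _ (chain_acB Vac fac).
  move=> x y xab yab /(nV _ _ xab yab) /=; have := ler_norm (f y - f x); lra.
(* [f] is [tv_fun a f] minus [tv_fun a f \- f], and the densities subtract likewise. *)
exists (g \- h).
  exact: (integrableB measurableT ig ih).
move=> x ax xb; rewrite RintegralB//.
- by rewrite -gE// -hE//=; ring.
- exact: integrableS ig.
- exact: integrableS ih.
Qed.

Lemma ac_derive1 a b f g : a < b ->
  mu.-integrable setT (EFin \o g) ->
  (forall x, a <= x -> x <= b -> f x - f a = \int[mu]_(t in `]a, x]) g t) ->
  {ae mu, forall x, x \in `]a, b[ -> derive1 f x = g x}.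
Proof.
move=> ab ig gE.
have [y||N [mN N0 HN]] := @FTC1 R g (BRight a).
- exact: integrableS ig.
- by apply: open_integrable_locally; [exact: openT|exact: ig].
exists N; split => //; apply: subset_trans HN; apply: subsetC => x /= H.
rewrite in_itv/= => /andP[ax xb].
have [dF <-] := H ax.
rewrite !derive1E; set F := (fun x => _) in dF *.
(* Near an interior point [f] is the primitive [F] plus the constant [f a]. *)
have -> : 'D_1 F x = 'D_1 (F \+ cst (f a)) x.
  by rewrite deriveD// derive_cst addr0.
apply: near_eq_derive => //.
near=> y; rewrite /F/= -gE ?subrK//; apply: ltW.
- by near: y; exact: lt_nbhsr.
- by near: y; exact: lt_nbhsl.
Unshelve. all: by end_near. Qed.

End absolutely_continuous_integral.

(* No measurability is assumed, in particular none of [derive1 f]: the integral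
   of a nonnegative function is a supremum over simple functions below it. *)
Lemma ge0_le_integral_patch d (T : measurableType d) (R : realType)
    (mu : {measure set T -> \bar R}) (D E : set T) (f g : T -> \bar R) :
  (forall x, D x -> (0 <= f x)%E) -> (forall x, E x -> (0 <= g x)%E) ->
  (forall x, ((f \_ D) x <= (g \_ E) x)%E) ->
  (\int[mu]_(x in D) f x <= \int[mu]_(x in E) g x)%E.
Proof.
move=> f0 g0 fg; rewrite !ge0_integralE//; apply: ge_ereal_sup => _ [h hf <-].
apply: ereal_sup_ubound; exists h => // x.
exact: le_trans (hf x) (fg x).
Qed.

(** * Explicit integrals of [c * x] and [c / x] *)

Section primitives.
Context {R : realType}.
Implicit Types (a b c : R) (f F : R -> R).

Notation mu := (@lebesgue_measure R).

Lemma is_derive_integral a b f F : a <= b ->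
  (forall x, a <= x -> x <= b -> is_derive x 1 F (f x)) ->
  (forall x, a <= x -> x <= b -> {for x, continuous f}) ->
  (\int[mu]_(x in `]a, b]) (f x)%:E = (F b - F a)%:E)%E.
Proof.
rewrite le_eqVlt => /predU1P[->|ab] dF cf.
  by rewrite set_itvoc0 integral_set0 subrr.
have cf' : {within `[a, b], continuous f}.
  apply: continuous_in_subspaceT => x; rewrite inE/= in_itv/= => /andP[ax xb].
  exact: cf.
have dF' x : a <= x -> x <= b -> derivable F x 1.
  by move=> ax xb; have [] := dF x ax xb.
have cF x : a <= x -> x <= b -> {for x, continuous F}.
  move=> ax xb; apply: differentiable_continuous; apply/derivable1_diffP.
  exact: dF'.
rewrite integral_itv_obnd_cbnd; last first.
  have mf := subspace_continuous_measurable_fun (measurable_itv _) cf'.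
  apply/measurable_EFinP; apply: measurable_funS mf => //.
  by apply: subset_itvr; rewrite bnd_simp.
rewrite (continuous_FTC2 ab cf' (F := F)) ?EFinB//.
- split.
  + by move=> x; rewrite in_itv/= => /andP[/ltW ? /ltW ?]; exact: dF'.
  + by apply: cvg_at_right_filter; apply: cF => //; exact: ltW.
  + by apply: cvg_at_left_filter; apply: cF => //; exact: ltW.
- move=> x; rewrite in_itv/= => /andP[/ltW ax /ltW xb].
  by rewrite derive1E; have [] := dF x ax xb.
Qed.

Lemma integral_linear a b c : a <= b ->
  (\int[mu]_(x in `]a, b]) (c * x)%:E =
    (c / 2 * (b ^+ 2 - a ^+ 2))%:E)%E.
Proof.
move=> ab; pose F (x : R) := c / 2 * x ^+ 2.
rewrite mulrBr; apply: (@is_derive_integral _ _ _ F) => //.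
- move=> x _ _; rewrite /F; apply: is_derive_eq.
  by rewrite /GRing.scale/=; field.
- by move=> x _ _; apply: cvgM; [exact: cvg_cst|exact: cvg_id].
Qed.

Lemma integral_reciprocal a b c : 0 < a -> a <= b ->
  (\int[mu]_(x in `]a, b]) (c / x)%:E = (c * (ln b - ln a))%:E)%E.
Proof.
move=> a0 ab; pose F (x : R) := c * ln x.
rewrite mulrBr; apply: (@is_derive_integral _ _ _ F) => //.
- move=> x ax _; have x0 := lt_le_trans a0 ax.
  have := is_derive1_ln x0; rewrite /F => ?; apply: is_derive_eq.
  by rewrite /GRing.scale/=.
- move=> x ax _; apply: cvgM; first exact: cvg_cst.
  by apply: cvgV; [rewrite gt_eqF// (lt_le_trans a0)|exact: cvg_id].
Qed.

End primitives.

(** * Pointwise bounds on [f] by its energy *)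

Section energy_estimates.
Context {R : realType}.
Implicit Types (a b r l omega : R) (f : R -> R).

Notation mu := (@lebesgue_measure R).

Lemma measurable_inv_itvoc a b : 0 <= a ->
  measurable_fun `]a, b] (fun x : R => x^-1).
Proof.
move=> a0; apply: (measurable_funS (E := (`]0, +oo[%classic : set R))).
- exact: measurable_itv.
- by apply: subset_itv; rewrite bnd_simp.
apply: open_continuous_measurable_fun; first exact: interval_open.
move=> x; rewrite inE/= in_itv/= andbT => x0.
by apply: inv_continuous; rewrite gt_eqF.
Qed.

Lemma energy_ge0 f : (0 <= energy f)%E.
Proof.
apply: integral_ge0 => x /=; rewrite in_itv/= => /andP[x0 _].
by rewrite lee_fin divr_ge0// ltW.
Qed.

(** Removing a null set leaves the integral of the measurable [g] unchanged; on what remains [g]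
    equals [derive1 f], so the comparison with the energy is pointwise. *)
Lemma le_integral_energy f g a b : 0 < a -> b < 1 ->
  measurable_fun `]a, b] g ->
  {ae mu, forall x, x \in `]a, b[ -> derive1 f x = g x} ->
  (\int[mu]_(x in `]a, b]) (`|g x| ^+ 2 / x)%:E <= energy f)%E.
Proof.
move=> a0 b1 mg [N [mN N0 HN]].
have pos x : x \in `]a, b] -> 0 < x.
  by rewrite in_itv/= => /andP[ax _]; exact: lt_trans ax.
(* The almost everywhere equality concerns the open interval, so [b] is removed as well. *)
pose M := N `|` [set b].
have mM : measurable M by apply: measurableU => //; exact: measurable_set1.
have M0 : mu M = 0.
  apply/eqP; rewrite eq_le measure_ge0 andbT.
  have UM : (mu M <= mu N + mu [set b])%E.
    by apply: measureU2 => //; exact: measurable_set1.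
  by apply: le_trans UM _; rewrite N0 lebesgue_measure_set1 add0e.
rewrite (ge0_negligible_integral mM)//; last 2 first.
- apply/measurable_EFinP; apply: measurable_funM.
    by apply: measurable_funX; exact: measurableT_comp.
  by apply: measurable_inv_itvoc; exact: ltW.
- by move=> x /= /pos x0; rewrite lee_fin divr_ge0// ltW.
apply: ge0_le_integral_patch.
- by move=> x [/= /pos x0 _]; rewrite lee_fin divr_ge0// ltW.
- move=> x /=; rewrite in_itv/= => /andP[/ltW x0 _].
  by rewrite lee_fin divr_ge0.
move=> x; rewrite !patchE; case: ifPn; last first.
  move=> _; case: ifPn => //; rewrite inE/= in_itv/= => /andP[/ltW x0 _].
  by rewrite lee_fin divr_ge0.
rewrite inE => -[/= xab NMx]; have x0 := pos _ xab.
have xNb : x != b by apply/eqP => xb; apply: NMx; right.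
move: xab; rewrite in_itv/= => /andP[ax xb].
have xltb : x < b by rewrite lt_neqAle xNb.
rewrite ifT; last by rewrite inE/= in_itv/= x0 (lt_trans xltb).
suff -> : derive1 f x = g x by [].
apply: contrapT => fg; apply: NMx; left; apply: HN => /= H; apply: fg.
by apply: H; rewrite in_itv/= ax.
Qed.

(** Cauchy-Schwarz in additive form: the weight [l] is free and is chosen later. *)
Lemma dist_le_energy f a r l : locally_abs_continuous 0 1 f ->
  (energy f < +oo)%E -> 0 < a -> a < r -> r < 1 -> 0 < l ->
  `|f r - f a| <= l / 4 * r ^+ 2 + fine (energy f) / (2 * l).
Proof.
move=> fac Efin a0 ar r1 l0.
have /abs_continuous_chain_ac ac := fac a r a0 (ltW ar) r1.
have [g ig gE] := ac_integral ar ac.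
have gae := ac_derive1 ar ig gE.
have mg : measurable_fun `]a, r] g.
  by apply/measurable_EFinP; apply: measurable_funTS; case/integrableP: ig.
have pos x : x \in `]a, r] -> 0 < x.
  by rewrite in_itv/= => /andP[ax _]; exact: lt_trans ax.
have Ef : energy f \is a fin_num by rewrite ge0_fin_numE// energy_ge0.
rewrite (gE r (ltW ar) (lexx r)).
have mD : measurable (`]a, r]%classic : set (measurableTypeR R)).
  exact: measurable_itv.
have mgn : measurable_fun `]a, r] (fun x => (`|g x|)%:E).
  by apply/measurable_EFinP; exact: measurableT_comp.
have mlin : measurable_fun `]a, r] (fun x => (l / 2 * x)%:E).
  apply/measurable_EFinP; apply: measurable_funTS; exact: mulrl_measurable.
have mquot : measurable_fun `]a, r] (fun x => (`|g x| ^+ 2 / x)%:E).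
  apply/measurable_EFinP; apply: measurable_funM.
    by apply: measurable_funX; exact: measurableT_comp.
  by apply: measurable_inv_itvoc; exact: ltW.
have mlquot : measurable_fun `]a, r]
    (fun x => ((2 * l)^-1)%:E * (`|g x| ^+ 2 / x)%:E)%E.
  by apply: emeasurable_funM => //; exact: measurable_cst.
rewrite -lee_fin.
apply: (@le_trans _ _ (\int[mu]_(x in `]a, r]) (`|g x|)%:E)%E).
  have igD := integrableS measurableT mD (@subsetT _ _) ig.
  have mgD : measurable_fun `]a, r] (EFin \o g) by exact/measurable_EFinP.
  have gfin := integrable_fin_num mD igD.
  have := le_abse_integral mu mD mgD.
  by rewrite -{1}(fineK gfin).
(* AM-GM: [|g| <= l x / 2 + g^2 / (2 l x)] *)
apply: (@le_trans _ _ (\int[mu]_(x in `]a, r])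
    ((l / 2 * x)%:E + ((2 * l)^-1%:E * (`|g x| ^+ 2 / x)%:E)))%E).
  apply: ge0_le_integral => //.
  - exact: emeasurable_funD.
  - move=> x /= /pos x0; rewrite -EFinM -EFinD lee_fin.
    (* The gap in AM-GM is an explicit square over a positive number. *)
    have -> : l / 2 * x + (2 * l)^-1 * (`|g x| ^+ 2 / x) =
      `|g x| + (l * x - `|g x|) ^+ 2 / (2 * l * x).
      by field; rewrite !gt_eqF.
    by rewrite lerDl divr_ge0 ?sqr_ge0// !mulr_ge0// ltW.
rewrite ge0_integralD//; last 2 first.
- by move=> x /= /pos x0; rewrite lee_fin !mulr_ge0// ltW.
- move=> x /= /pos x0; rewrite -EFinM lee_fin mulr_ge0//.
    by rewrite invr_ge0 mulr_ge0// ltW.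
  by rewrite divr_ge0// ltW.
rewrite ge0_integralZl_EFin//; last 2 first.
- by move=> x /= /pos x0; rewrite lee_fin divr_ge0// ltW.
- by rewrite invr_ge0 mulr_ge0// ltW.
rewrite (integral_linear _ (ltW ar)) EFinD leeD//.
  rewrite lee_fin.
  have : 0 <= l * a ^+ 2 by rewrite mulr_ge0 ?sqr_ge0// ltW.
  lra.
rewrite [fine _ / _]mulrC EFinM fineK//.
rewrite lee_pmul2l ?lte_fin ?invr_gt0 ?mulr_gt0//.
exact: le_integral_energy.
Qed.

Lemma sqr_le_energy f r : locally_abs_continuous 0 1 f ->
  f x @[x --> 0^'+] --> 0 -> (energy f < +oo)%E -> 0 < r -> r < 1 ->
  `|f r| ^+ 2 <= fine (energy f) / 2 * r ^+ 2.
Proof.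
move=> fac f0 Efin r0 r1.
set E := fine (energy f).
have E0 : 0 <= E by rewrite fine_ge0// energy_ge0.
have [->|fr0] := eqVneq (f r) 0.
  by rewrite normr0 expr0n/= mulr_ge0 ?sqr_ge0// divr_ge0.
have u0 : 0 < `|f r| by rewrite normr_gt0.
(* This is [dist_le_energy] with [a] tending to 0, where [f a] vanishes. *)
have key l : 0 < l -> `|f r| <= l / 4 * r ^+ 2 + E / (2 * l).
  move=> l0; apply/ler_addgt0Pr => e e0.
  have : \forall a \near 0^'+, `|f a| < e.
    by move/cvgr0Pnorm_lt : f0; exact.
  move=> fe; near (0:R)^'+ => a.
  have a0 : 0 < a by [].
  have ar : a < r by near: a; exact: nbhs_right_lt.
  have fae : `|f a| < e by near: a.
  have := dist_le_energy fac Efin a0 ar r1 l0; rewrite -/E.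
  have := ler_normB (f r - f a) (- f a).
  rewrite opprK subrK normrN; lra.
(* The minimiser of the bound, [sqrt (2 E) / r], degenerates at [E = 0]. This [l] is its value when
   the claim is an equality; it is positive since [f r] is nonzero, and half of [f r] is then
   absorbed on the left. *)
have l0 : 0 < 2 * `|f r| / r ^+ 2 by rewrite !mulr_gt0// invr_gt0 exprn_gt0.
have := key _ l0.
have -> : 2 * `|f r| / r ^+ 2 / 4 * r ^+ 2 + E / (2 * (2 * `|f r| / r ^+ 2)) =
  `|f r| / 2 + E * r ^+ 2 / (4 * `|f r|).
  by field; rewrite !gt_eqF.
move=> H.
have {}H : `|f r| / 2 <= E * r ^+ 2 / (4 * `|f r|) by lra.
rewrite ler_pdivlMr ?mulr_gt0// in H.
rewrite expr2; lra.
Unshelve. all: by end_near. Qed.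

End energy_estimates.

(** * Splitting the integral at [d] and choosing [d] *)

Lemma split_energy_bound (R : realType) (f : R -> R) (omega e d : R) :
  0 <= e -> 0 < d -> d <= 1 ->
  (forall r : R, 0 < r -> r < 1 -> `|f r| <= omega) ->
  (forall r : R, 0 < r -> r < 1 -> `|f r| ^+ 2 <= e / 2 * r ^+ 2) ->
  (\int[lebesgue_measure]_(r in `]0%R, 1%R[) (`|f r| ^+ 2 / r)%:E <=
   (e / 4 * d ^+ 2 - omega ^+ 2 * ln d)%:E)%E.
Proof.
move=> e0 d0 d1 fw fe.
pose u (r : R) : \bar R := (e / 2 * r)%:E.
pose v (r : R) : \bar R := (omega ^+ 2 / r)%:E.
have pos_d (r : R) : `]d, 1]%classic r -> 0 < r.
  by rewrite /= in_itv/= => /andP[dr _]; exact: lt_trans dr.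
have u0 x : (0 <= (u \_ `]0%R, d]) x)%E.
  rewrite patchE; case: ifPn => //; rewrite inE/= in_itv/= => /andP[x0 _].
  by rewrite lee_fin !mulr_ge0// ltW.
have v0 x : (0 <= (v \_ `]d, 1%R]) x)%E.
  rewrite patchE; case: ifPn => //; rewrite inE => /pos_d x0.
  by rewrite lee_fin divr_ge0 ?sqr_ge0// ltW.
have mu : measurable_fun setT (u \_ `]0%R, d]).
  apply/(measurable_restrictT _ _).1; first exact: measurable_itv.
  by apply/measurable_EFinP; apply: measurable_funTS; exact: mulrl_measurable.
have mv : measurable_fun setT (v \_ `]d, 1%R]).
  apply/(measurable_restrictT _ _).1; first exact: measurable_itv.
  apply/measurable_EFinP; apply: measurable_funM; first exact: measurable_cst.
  by apply: measurable_inv_itvoc; exact: ltW.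
have Eu : (\int[lebesgue_measure]_(r in `]0%R, d]) u r = (e / 4 * d ^+ 2)%:E)%E.
  by rewrite /u integral_linear ?ltW//; congr EFin; field.
have Ev : (\int[lebesgue_measure]_(r in `]d, 1%R]) v r =
    (- (omega ^+ 2 * ln d))%:E)%E.
  by rewrite /v integral_reciprocal// ln1 sub0r mulrN.
(* Both majorants are extended by 0 and added, so a single pointwise comparison suffices. *)
rewrite EFinD -Eu -Ev [X in (_ <= X + _)%E]integral_mkcond.
rewrite [X in (_ <= _ + X)%E]integral_mkcond -ge0_integralD//.
apply: ge0_le_integral_patch => [x /=|x _|x].
- by rewrite in_itv/= => /andP[/ltW x0 _]; rewrite lee_fin divr_ge0.
- exact: adde_ge0.
rewrite patch_setT [X in (X <= _)%E]patchE; case: ifPn; last first.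
  by move=> _; exact: adde_ge0.
rewrite inE/= in_itv/= => /andP[x0 x1].
have [xd|dx] := leP x d.
  apply: le_trans (leeDl _ (v0 x)).
  rewrite patchE ifT; last by rewrite inE/= in_itv/= x0.
  by rewrite lee_fin ler_pdivrMr// (le_trans (fe _ x0 x1))// expr2 mulrA.
apply: le_trans (leeDr _ (u0 x)).
rewrite patchE ifT; last by rewrite inE/= in_itv/= dx ltW.
rewrite lee_fin ler_pM2r ?invr_gt0//.
by rewrite ler_sqr ?nnegrE ?fw// (le_trans _ (fw x x0 x1)).
Qed.

Theorem lemma7p1 (R : realType) (f : R -> R) (omega : R)
  (homega : 0 <= omega)
  (fac : locally_abs_continuous 0 1 f)
  (f0 : f r @[r --> 0^'+] --> 0)
  (fbound : forall r : R, 0 < r -> r < 1 -> `|f r| <= omega)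
  (Efin : (energy f < +oo)%E) :
  (\int[lebesgue_measure]_(r in `]0%R, 1%R[) (`|f r| ^+ 2 / r)%:E <=
   (if omega == 0 then 0
    else omega ^+ 2 *
           (1 / 4 + 1 / 2 * ln (1 + fine (energy f) / omega ^+ 2)))%:E)%E.
Proof.
have [w0|wn0] := eqVneq omega 0.
  rewrite integral0_eq// => r /=; rewrite in_itv/= => /andP[r0 r1].
  have := fbound r r0 r1; rewrite w0 normr_le0 => /eqP ->.
  by rewrite normr0 expr0n/= mul0r.
have w0 : 0 < omega by rewrite lt_neqAle eq_sym wn0.
set e := fine (energy f).
have e0 : 0 <= e by rewrite fine_ge0// energy_ge0.
set q := 1 + e / omega ^+ 2.
have q1 : 1 <= q by rewrite lerDl divr_ge0// sqr_ge0.
have q0 : 0 < q by exact: lt_le_trans q1.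
(* The exact minimiser has [d^2 = 2 omega^2 / e], which may exceed 1. This [d] never does, and it
   makes the logarithmic term equal to the one in the claim. *)
pose d := Num.sqrt q^-1.
have d0 : 0 < d by rewrite sqrtr_gt0 invr_gt0.
have dq : d ^+ 2 = q^-1 by rewrite sqr_sqrtr// invr_ge0 ltW.
have d1 : d <= 1.
  by rewrite -(ler_sqr (ltW d0)) ?nnegrE// dq expr1n invf_le1.
have lnd : ln d = - (1 / 2 * ln q).
  have : ln (d ^+ 2) = - ln q by rewrite dq lnV// posrE.
  rewrite lnXn// mulr2n; lra.
have fe r : 0 < r -> r < 1 -> `|f r| ^+ 2 <= e / 2 * r ^+ 2.
  by move=> r0 r1; exact: sqr_le_energy.
apply: le_trans (split_energy_bound e0 d0 d1 fbound fe) _.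
rewrite lee_fin lnd mulrN opprK mulrDr lerD2r dq.
have -> : e = omega ^+ 2 * (q - 1) by rewrite /q; field.
rewrite -mulrA -mulrA ler_pM2l ?exprn_gt0//.
(* The other term is [omega^2 / 4] times [(q - 1) / q], whence the constant [1 / 4]. *)
have : (q - 1) * q^-1 <= 1 by rewrite ler_pdivrMr//; lra.
lra.
Qed.
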